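(* Let $F$ be a probability distribution function on $\mathbb{R}$ with finite mean $\mu$. (a) If the support of $F$ is contained in $[a,b]$ with $a,b\in\mathbb{R}$, then there exist random variables $X_i\sim F$, $i\in\mathbb{N}$, such that for each $n\in\mathbb{N}$, with $S_n=X_1+\cdots+X_n$, $$|S_n-n\mu|\le b-a.$$ (b) There exist random variables $X_i\sim F$, $i\in\mathbb{N}$, such that, with $S_n=X_1+\cdots+X_n$, for any sequence $k_n\to\infty$ as $n\to\infty$ one has $(S_n-n\mu)/k_n\to 0$ almost surely. In other words, there exists an extremely negatively dependent (END) sequence of random variables from $F$.
   Context: All random variables are defined on a common atomless probability space $(\Omega,\mathcal A,\mathbb P)$, on which independent random vectors with any distributions can be generated; inequalities between random variables are understood almost surely. $X\sim F$ means that $X$ has distribution function $F$. A sequence $(X_i,\,i\in\mathbb{N})$ of random variables with common distribution $F$ with finite mean $\mu$ is called extremely negatively dependent (END) if, with $S_n=X_1+\cdots+X_n$, $(S_n-n\mu)/k_n\to 0$ a.s. for any $k_n\to\infty$ as $n\to\infty$. *)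

(* Defs.v *)
From mathcomp Require Import all_boot all_order all_algebra.
From mathcomp Require Import all_classical all_reals all_analysis.

Set Implicit Arguments.
Unset Strict Implicit.
Unset Printing Implicit Defensive.

Import Order.TTheory GRing.Theory Num.Theory.
Import numFieldNormedType.Exports.

Local Open Scope classical_set_scope.
Local Open Scope ring_scope.

Definition atomless (d : measure_display) (T : measurableType d)
    (R : realType) (P : probability T R) : Prop :=
  forall A : set T, measurable A -> (0 < P A)%E ->
    exists B : set T,
      [/\ measurable B, B `<=` A, (0 < P B)%E & (P B < P A)%E].

(* The product rule over the whole finite family suffices: taking some of the
   A i to be the full space gives the rule for every subfamily. *)
Definition mutually_independent (d : measure_display) (T : measurableType d)
    (R : realType) (P : probability T R) (m : nat)
    (d' : 'I_m -> measure_display) (T' : forall i, measurableType (d' i))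
    (X : forall i, {RV P >-> T' i}) : Prop :=
  forall A : forall i, set (T' i), (forall i, measurable (A i)) ->
    P (\bigcap_(i in [set: 'I_m]) (X i @^-1` A i)) =
    (\prod_(i < m) P (X i @^-1` A i))%E.

(* Independent random vectors with arbitrary laws nu i, of arbitrary
   dimensions dim i, exist on the probability space. Only finite families are
   required. *)
Definition generates_independent_vectors (d : measure_display)
    (T : measurableType d) (R : realType) (P : probability T R) : Prop :=
  forall (m : nat) (dim : 'I_m -> nat)
    (nu : forall i : 'I_m, probability ((dim i).-tuple R) R),
  exists X : forall i : 'I_m, {RV P >-> (dim i).-tuple R},
    mutually_independent X /\
    forall (i : 'I_m) (A : set ((dim i).-tuple R)),
      measurable A -> distribution P (X i) A = nu i A.

(* A probability distribution function F is a [cumulativeBounded 0 1]: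
   nondecreasing, right-continuous, with limits 0 and 1 at -oo and +oo.
   Its law is [lebesgue_stieltjes_measure F]. *)
Definition has_distribution_function (d : measure_display)
    (T : measurableType d) (R : realType) (P : probability T R)
    (X : {RV P >-> R}) (F : cumulativeBounded (0 : R) (1 : R)) : Prop :=
  forall x : R, cdf X x = (F x)%:E.

Definition finite_mean (R : realType)
    (F : cumulativeBounded (0 : R) (1 : R)) : Prop :=
  (lebesgue_stieltjes_measure F).-integrable [set: R] (fun x : R => x%:E).

Definition distribution_mean (R : realType)
    (F : cumulativeBounded (0 : R) (1 : R)) : R :=
  \int[lebesgue_stieltjes_measure F]_x x.

Definition distribution_support (R : realType)
    (F : cumulativeBounded (0 : R) (1 : R)) : set R :=
  [set x | forall U : set R, open_nbhs x U ->
             (0 < lebesgue_stieltjes_measure F U)%E].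

(* Sequences are indexed from 0, so this is the sum of the first n terms. *)
Definition partial_sum (d : measure_display) (T : measurableType d)
    (R : realType) (P : probability T R) (X : nat -> {RV P >-> R})
    (n : nat) (w : T) : R :=
  \sum_(i < n) X i w.

(* The values k n that vanish are finitely many, hence irrelevant to the
   limit. *)
Definition extremely_negatively_dependent (d : measure_display)
    (T : measurableType d) (R : realType) (P : probability T R)
    (F : cumulativeBounded (0 : R) (1 : R)) (X : nat -> {RV P >-> R}) : Prop :=
  [/\ finite_mean F,
      forall i : nat, has_distribution_function (X i) F
    & forall k : nat -> R, k n @[n --> \oo] --> +oo ->
        {ae P, forall w : T,
          (partial_sum X n w - n%:R * distribution_mean F) / k n
            @[n --> \oo] --> (0 : R)}].

(* Main.v *)
Require Import Defs.
From mathcomp Require Import all_boot all_order all_algebra.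
From mathcomp Require Import all_classical all_reals all_analysis.
From mathcomp Require Import measurable_realfun ring lra.

Set Implicit Arguments.
Unset Strict Implicit.
Unset Printing Implicit Defensive.

Import Order.TTheory GRing.Theory Num.Theory.
Import numFieldNormedType.Exports.

Local Open Scope classical_set_scope.
Local Open Scope ring_scope.

(* A law mu with mean m is a mixture of laws with mean m carried by two points
   x <= m < y. For fixed x and y the two-interval exchange of [0, y - x[ that
   moves v by m - x if v < y - m, and by m - y otherwise, preserves Lebesgue
   measure; reading off x or y according to the branch taken, the sum of the
   first n values minus n * m telescopes to v - v_n, where v_n is the n-th
   iterate of v, so it is bounded by y - x. Weighting x and y by the length
   y - x amounts to drawing (x, y, v) from the restriction of
   mu * mu * Lebesgue to {x <= m < y, 0 <= v < y - x}, and then every value has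
   law mu. *)

Lemma measurable_coords (R : realType) (mR := measurableTypeR R) :
  [/\ measurable_fun setT (fun p : mR * mR * mR => p.1.1 : R),
      measurable_fun setT (fun p : mR * mR * mR => p.1.2 : R)
    & measurable_fun setT (fun p : mR * mR * mR => p.2 : R)].
Proof.
split; last exact: measurable_snd.
  exact: (measurableT_comp (@measurable_fst _ _ mR mR) measurable_fst).
exact: (measurableT_comp (@measurable_snd _ _ mR mR) measurable_fst).
Qed.

(** * The two-interval exchange and its telescoping sums *)

Section exchange.
Variables (R : realType) (m : R).
Implicit Types p : R * R * R.

Definition exch_region : set (R * R * R) :=
  [set p | p.1.1 <= m < p.1.2 /\ 0 <= p.2 < p.1.2 - p.1.1].

Definition exch_step p : R := if p.2 < p.1.2 - m then p.1.1 else p.1.2.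

Definition exch_map p : R * R * R := (p.1, p.2 - (exch_step p - m)).

(** The first branch carries [[0, y - m[] onto [[m - x, y - x[], the second carries [[y - m, y - x[]
    onto [[0, m - x[]. *)
Lemma exch_map_region p : exch_region p -> exch_region (exch_map p).
Proof.
case=> xmy vL; split => //=; rewrite /exch_step; case: ltP => h; lra.
Qed.

Lemma iter_exch_map1 n p : (iter n exch_map p).1 = p.1.
Proof. by elim: n => //= n ->. Qed.

Lemma sum_exch_step n p :
  \sum_(i < n) exch_step (iter i exch_map p) - n%:R * m =
  p.2 - (iter n exch_map p).2.
Proof.
elim: n => [|n IHn]; first by rewrite big_ord0 /=; ring.
rewrite big_ord_recr /= -natr1.
move: IHn; set s := \sum_(i < n) _; lra.
Qed.

(** The first two coordinates never change, so the last coordinates of [p] and of its iterate lie in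
    the same interval [[0, y - x[], and the telescoped sum is their difference. *)
Lemma sum_exch_step_le n p : exch_region p ->
  `|\sum_(i < n) exch_step (iter i exch_map p) - n%:R * m| <= p.1.2 - p.1.1.
Proof.
move=> Dp; have : exch_region (iter n exch_map p).
  by elim: n => //= n; exact: exch_map_region.
rewrite sum_exch_step /exch_region/= iter_exch_map1 ler_norml; case: Dp; lra.
Qed.

Local Notation mR := (measurableTypeR R).

Lemma measurable_exch_step :
  measurable_fun [set: mR * mR * mR] (exch_step : mR * mR * mR -> R).
Proof.
have [m1 m2 m3] := measurable_coords R.
rewrite /exch_step; apply: measurable_fun_ifT => //.
by apply: measurable_fun_ltr => //; exact: measurable_funB.
Qed.

Lemma measurable_exch_map :
  measurable_fun [set: mR * mR * mR] (exch_map : mR * mR * mR -> mR * mR * mR).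
Proof.
apply: measurable_fun_pair => //=.
apply: (@measurable_funB _ _ R setT (fun p : mR * mR * mR => p.2 : R)).
  exact: measurable_snd.
apply: measurable_funB => //; exact: measurable_exch_step.
Qed.

Lemma measurable_exch_region : measurable (exch_region : set (mR * mR * mR)).
Proof.
have [m1 m2 m3] := measurable_coords R.
have mr : measurable_fun [set: mR * mR * mR] (fun p : mR * mR * mR =>
    ((p.1.1 <= m) && (m < p.1.2)) && ((0 <= p.2) && (p.2 < p.1.2 - p.1.1))).
  apply: measurable_and; apply: measurable_and.
  - exact: measurable_fun_ler.
  - exact: measurable_fun_ltr.
  - exact: measurable_fun_ler.
  - by apply: measurable_fun_ltr => //; exact: measurable_funB.
have := mr measurableT [set true] I; rewrite setTI.
congr measurable; apply/seteqP; split => p /=; first by move/andP.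
by case=> -> ->.
Qed.

End exchange.

(** * Translation invariance and integrals of tensor products *)

Section translation.
Variable R : realType.

(** By uniqueness of Lebesgue measure it is enough that the pushforward under the shift agrees with
    it on half-open intervals. *)
Lemma lebesgue_measure_shift (t : R) (A : set (measurableTypeR R)) :
  measurable A ->
  lebesgue_measure ((fun v : measurableTypeR R => (v : R) + t) @^-1` A) =
  lebesgue_measure A.
Proof.
have mt : measurable_fun setT
    ((fun v => (v : R) + t) : measurableTypeR R -> measurableTypeR R).
  by apply: (@measurable_funD _ (measurableTypeR R) R) => //.
pose ft : {mfun measurableTypeR R >-> measurableTypeR R} :=
  @mfun_Sub _ _ (measurableTypeR R) (measurableTypeR R) _ (mem_set mt).
move=> mA; apply/esym.
apply: (lebesgue_measure_unique (mu := pushforward lebesgue_measure ft)) => //.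
move=> _ [[a b]] _ <-; transitivity (lebesgue_measure `]a - t, b - t]%classic).
  rewrite !lebesgue_measure_itv/= !lte_fin ltrD2r; case: ifP => // _.
  by congr (_%:E); ring.
rewrite /pushforward; congr lebesgue_measure.
by apply/seteqP; split => v /=; rewrite !in_itv/=; lra.
Qed.

End translation.

Section tensor_integral.
Local Open Scope ereal_scope.
Context d1 d2 (T1 : measurableType d1) (T2 : measurableType d2) (R : realType).
Variables (m1 : {sigma_finite_measure set T1 -> \bar R})
  (m2 : {sigma_finite_measure set T2 -> \bar R}).

Lemma ge0_integral_tensor (f : T1 -> \bar R) (g : T2 -> \bar R) :
  measurable_fun setT f -> measurable_fun setT g ->
  (forall x, 0 <= f x) -> (forall y, 0 <= g y) ->
  \int[m1 \x m2]_z (f z.1 * g z.2) = \int[m1]_x f x * \int[m2]_y g y.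
Proof.
move=> mf mg f0 g0; rewrite fubini_tonelli1.
- rewrite /fubini_F -ge0_integralZr//; last exact: integral_ge0.
  by apply: eq_integral => x _ /=; rewrite ge0_integralZl.
- by apply: emeasurable_funM; exact: measurableT_comp.
- by move=> x; exact: mule_ge0.
Qed.

End tensor_integral.

(** * Lebesgue measure of the fibres over a fixed pair of endpoints *)

Section sections.
Local Open Scope ereal_scope.
Variables (R : realType) (m : R).
Local Notation mR := (measurableTypeR R).
Local Notation leb := (@lebesgue_measure R).

(** Over a fixed pair the exchange is a rearrangement of [[0, y - x[] by two translations. The
    section [B] of [A] is cut at [m - x], where the images of the two branches meet. *)
Lemma lebesgue_xsection_exch_map (A : set (mR * mR * mR)) (q : mR * mR) :
  measurable A ->
  leb (xsection (exch_region m `&`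
    (exch_map m : mR * mR * mR -> mR * mR * mR) @^-1` A) q)
  = leb (xsection (exch_region m `&` A) q).
Proof.
move=> mA; case: q => x y.
have mB : measurable (xsection A (x, y)) by exact: measurable_xsection.
have [xmy|xmy] := boolP ((x <= m < y)%R); last first.
  rewrite (_ : xsection _ _ = set0) 1?[in RHS](_ : xsection _ _ = set0) //.
    by apply/seteqP; split => v //; rewrite /xsection/= inE => -[[/=]];
      rewrite (negbTE xmy).
  by apply/seteqP; split => v //; rewrite /xsection/= inE => -[[/=]];
    rewrite (negbTE xmy).
set B := xsection A (x, y) in mB.
have BE v : B v = A (x, y, v) by rewrite /B /xsection/= inE.
have mBi (i : interval R) : measurable (B `&` [set` i] : set mR).
  by apply: (@measurableI _ mR) => //; exact: measurable_itv.
transitivity (leb (B `&` `[(m - x)%R, (y - x)%R[%classic) +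
              leb (B `&` `[0%R, (m - x)%R[%classic)).
  (* The shift by [m - x] pulls the upper piece back into [[0, y - m[], the shift by [m - y] pulls
     the lower piece back into [[y - m, y - x[]: these are the domains of the two branches. *)
  rewrite -(lebesgue_measure_shift (m - x)%R (mBi `[(m - x)%R, (y - x)%R[)).
  rewrite -(lebesgue_measure_shift (m - y)%R (mBi `[0%R, (m - x)%R[)).
  have ms t : measurable_fun setT ((fun v => (v : R) + t)%R : mR -> mR).
    by apply: (@measurable_funD _ mR R).
  rewrite -measureU//.
  - congr leb; apply/seteqP; split => v;
      rewrite /xsection/= inE !in_itv/= !BE /exch_map/exch_step/=.
      case=> -[/= _ vL]; case: ltP => vy Av; [left|right]; split.
      + by move: Av; congr (A (_, _)); ring.
      + lra.
      + by move: Av; congr (A (_, _)); ring.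
      + lra.
    case=> -[Av vL]; split.
    + by split => //=; lra.
    + rewrite ifT; last lra.
      by move: Av; congr (A (_, _)); ring.
    + by split => //=; lra.
    + rewrite ifF; last by apply/negbTE; rewrite -leNgt; lra.
      by move: Av; congr (A (_, _)); ring.
  - by rewrite -[X in measurable X]setTI; apply: ms => //; exact: mBi.
  - by rewrite -[X in measurable X]setTI; apply: ms => //; exact: mBi.
  - apply/seteqP; split => v //=; rewrite !in_itv/=; lra.
rewrite -measureU//; last first.
  by apply/seteqP; split => v //=; rewrite !in_itv/=; lra.
congr leb; rewrite -setIUr; apply/seteqP; split => v;
  rewrite /xsection/= inE !in_itv/= BE.
  by case=> Av vL; split => //; split => //=; case: vL; lra.
case=> -[/= _ vL] Av; split => //.
by have [?|?] := leP (m - x)%R v; [left|right]; lra.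
Qed.

(** The value [x] is read off on a length [y - m] and the value [y] on a length [m - x]. The
    indicators and maxima make both terms vanish unless [x <= m < y], so each term is a function of
    [x] times a function of [y], ready for Tonelli. *)
Lemma lebesgue_xsection_exch_step (E : set R) (q : mR * mR) : measurable E ->
  leb (xsection
    (exch_region m `&` (exch_step m : mR * mR * mR -> R) @^-1` E) q) =
  (\1_(E `&` `]-oo, m]) q.1)%:E * (Num.max (q.2 - m)%R 0%R)%:E +
  (Num.max (m - q.1)%R 0%R)%:E * (\1_(E `&` `]m, +oo[) q.2)%:E.
Proof.
move=> mE; case: q => x y /=.
have [xmy|xmy] := boolP ((x <= m < y)%R); last first.
  rewrite (_ : xsection _ _ = set0).
    rewrite measure0 !indicE !in_setI.
    move: xmy; rewrite negb_and -ltNge -leNgt.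
    rewrite !mem_setE !in_itv/= andbT; case: (ltP m x) => /= xm.
      rewrite andbF mul0e.
      by rewrite (max_idPr _) ?mul0e ?adde0// subr_le0 ltW.
    move=> ym; rewrite [(m < y)%R]ltNge ym andbF mule0.
    rewrite (max_idPr _) ?mule0 ?adde0//.
    by rewrite subr_le0.
  by apply/seteqP; split => v //; rewrite /xsection/= inE => -[[/=]];
    rewrite (negbTE xmy).
have -> : xsection
    (exch_region m `&` (exch_step m : mR * mR * mR -> R) @^-1` E) (x, y) =
   (if x \in E then `[0%R, (y - m)%R[%classic else set0) `|`
   (if y \in E then `[(y - m)%R, (y - x)%R[%classic else set0).
  apply/seteqP; split => v; rewrite /xsection/= inE /exch_step/=.
    case=> -[/= _ vL]; case: ltP => vy Ev; [left|right];
      rewrite ifT ?inE//= in_itv/=; lra.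
  case; case: ifPn => //= /set_mem Ev; rewrite in_itv/= => vL; split.
  - by split => //=; lra.
  - by rewrite ifT//; lra.
  - by split => //=; lra.
  - by rewrite ifF//; apply/negbTE; rewrite -leNgt; lra.
rewrite measureU//; first last.
- case: ifP; case: ifP => _ _; rewrite ?setI0 ?set0I//.
  by apply/seteqP; split => v //=; rewrite !in_itv/=; lra.
- by case: ifP.
- by case: ifP.
rewrite !indicE !in_setI !mem_setE !in_itv/=.
case/andP: (xmy) => xm my.
rewrite xm my/= !andbT !(max_idPl _) ?subr_ge0// ?ltW//.
congr (_ + _).
  case: ifP => _; rewrite ?mul0e ?measure0// lebesgue_measure_itv/=.
  rewrite lte_fin subr_gt0 my.
  by rewrite mul1e oppr0 adde0.
case: ifP => _; rewrite ?mule0 ?measure0// lebesgue_measure_itv/= lte_fin mule1.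
(* In the second case [x = m]: the interval is empty and its length [m - x] is zero. *)
case: ifPn => [_|xy]; last by (congr (_%:E); lra).
by congr (_%:E); ring.
Qed.

End sections.

Lemma measurable_max_sub (R : realType) (m : R) (mR := measurableTypeR R) :
  measurable_fun setT (fun y : mR => (Num.max (y - m) 0)%:E) /\
  measurable_fun setT (fun y : mR => (Num.max (m - y) 0)%:E).
Proof.
by split; apply/measurable_EFinP; apply: measurable_maxr => //;
  exact: (@measurable_funB _ mR).
Qed.

Lemma mnormalizeE d (T : measurableType d) (R : realType)
    (mu : {measure set T -> \bar R}) (P : probability T R) (c : R) (A : set T) :
  mu setT = c%:E -> c != 0 -> mnormalize mu P A = (mu A * c^-1%:E)%E.
Proof. by move=> muT /negbTE c0; rewrite /mnormalize muT eqe c0. Qed.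

(** * The normalized law on triples, and its invariance *)

Section exchange_law.
Local Open Scope ereal_scope.
Variables (R : realType) (m : R).
Local Notation mR := (measurableTypeR R).
Local Notation leb := (@lebesgue_measure R).
Variable mu : probability mR R.
Local Notation M := ((mu \x mu) \x leb).
Local Notation step := (exch_step m : mR * mR * mR -> R).
Local Notation emap := (exch_map m : mR * mR * mR -> mR * mR * mR).
Local Notation reg := (exch_region m : set (mR * mR * mR)).

Lemma measurable_iter_exch_map n :
  measurable_fun setT (iter n emap : mR * mR * mR -> mR * mR * mR).
Proof.
elim: n => [|n IHn]; first exact: measurable_id.
exact: (measurableT_comp (measurable_exch_map m) IHn).
Qed.

(** The product measure integrates the Lebesgue measure of fibres, so the fibrewise invariance under
    one exchange, applied to the preimage under [n] iterations, gives the induction step. *)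
Lemma measure_iter_exch_map n (A : set (mR * mR * mR)) : measurable A ->
  M (reg `&` iter n emap @^-1` A) = M (reg `&` A).
Proof.
move=> mA; elim: n => // n IHn; rewrite -IHn.
have mB : measurable (iter n emap @^-1` A).
  by rewrite -[X in measurable X]setTI; exact: measurable_iter_exch_map.
apply: eq_integral => q _ /=.
rewrite -(lebesgue_xsection_exch_map m q mB).
congr (leb (xsection (_ `&` _) _)).
by apply/funext => p; rewrite /preimage/= -iterSr.
Qed.

Lemma measure_exch_step (E : set mR) : measurable E ->
  M (reg `&` step @^-1` E) =
  mu (E `&` `]-oo, m]%classic) * \int[mu]_y (Num.max (y - m)%R 0%R)%:E +
  \int[mu]_x (Num.max (m - x)%R 0%R)%:E * mu (E `&` `]m, +oo[%classic).
Proof.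
move=> mE.
have mi (i : interval R) : measurable (E `&` [set` i] : set mR).
  by apply: (@measurableI _ mR) => //; exact: measurable_itv.
have [mm mm'] := measurable_max_sub m.
have mI (i : interval R) :
    measurable_fun setT (fun y : mR => (\1_(E `&` [set` i] : set mR) y : R)%:E).
  by apply/measurable_EFinP; exact: measurable_indic.
rewrite [LHS](_ : _ = \int[mu \x mu]_q (
    (\1_(E `&` `]-oo, m] : set mR) q.1)%:E * (Num.max (q.2 - m)%R 0%R)%:E +
    (Num.max (m - q.1)%R 0%R)%:E * (\1_(E `&` `]m, +oo[ : set mR) q.2)%:E)).
  rewrite ge0_integralD//.
  - rewrite (ge0_integral_tensor mu mu (mI _) mm)//; last first.
      by move=> ?; rewrite lee_fin le_max lexx orbT.
    rewrite (ge0_integral_tensor mu mu mm' (mI _))//; last first.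
      by move=> ?; rewrite lee_fin le_max lexx orbT.
    by rewrite !integral_indic// !setIT.
  - by move=> q _; rewrite mule_ge0// lee_fin ?le_max ?lexx ?orbT.
  - apply: emeasurable_funM.
      exact: (measurableT_comp (mI _) measurable_fst).
    exact: (measurableT_comp mm measurable_snd).
  - by move=> q _; rewrite mule_ge0// lee_fin ?le_max ?lexx ?orbT.
  - apply: emeasurable_funM.
      exact: (measurableT_comp mm' measurable_fst).
    exact: (measurableT_comp (mI _) measurable_snd).
by apply: eq_integral => q _ /=; rewrite lebesgue_xsection_exch_step.
Qed.

Hypothesis int_mu : mu.-integrable setT (fun x : mR => (x : R)%:E).
Hypothesis mean_mu : \int[mu]_x (x : R)%:E = m%:E.

(** The two maxima are the positive and negative parts of [x - m], an integrable function with
    integral zero. *)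
Lemma integral_max_mean : \int[mu]_x (Num.max (x - m)%R 0%R)%:E \is a fin_num /\
  \int[mu]_x (Num.max (m - x)%R 0%R)%:E = \int[mu]_x (Num.max (x - m)%R 0%R)%:E.
Proof.
pose f (x : mR) := (x : R)%:E - m%:E.
have mint : mu.-integrable setT (cst m%:E : mR -> _).
  exact: finite_measure_integrable_cst.
have intf : mu.-integrable setT f by exact: integrableB.
have : \int[mu]_x f x = 0.
  rewrite integralB// mean_mu integral_cst//= probability_setT mule1.
  by rewrite subee.
rewrite integralE.
have fp : f^\+ = (fun x : mR => (Num.max (x - m)%R 0%R)%:E).
  by apply/funext => x; rewrite funeposE /f -EFin_max.
have fn : f^\- = (fun x : mR => (Num.max (m - x)%R 0%R)%:E).
  by apply/funext => x; rewrite funenegE /f -EFinB -EFinN opprB -EFin_max.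
have pf := integrable_pos_fin_num measurableT intf.
have nf := integrable_neg_fin_num measurableT intf.
rewrite -fp -fn => /eqP; rewrite sube_eq// ?add0e => /eqP fE; rewrite -fE.
by split.
Qed.

(** [Q] is [M] restricted to [reg] and divided by its total mass [c], the mean of the positive part
    of [x - m]. The last clause will place both endpoints in any set of full [mu]-measure, such as
    an interval containing the support. *)
Lemma exchange_law : \int[mu]_x (Num.max (x - m)%R 0%R)%:E != 0 ->
  exists Q : probability (mR * mR * mR)%type R,
  [/\ Q (~` reg) = 0,
      forall n (E : set mR), measurable E ->
        Q ((step \o iter n emap) @^-1` E) = mu E
    & forall N : set mR, measurable N -> mu N = 0 ->
        Q [set p | N p.1.1] = 0 /\ Q [set p | N p.1.2] = 0].
Proof.
have [cfin c'c] := integral_max_mean.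
set c := (X in X != 0) => c0.
have cK : c = (fine c)%:E by rewrite fineK.
have mreg : measurable reg := measurable_exch_region m.
have mincr (E : set mR) : measurable E -> measurable (step @^-1` E).
  by move=> mE; rewrite -[X in measurable X]setTI; exact: measurable_exch_step.
(* Both integrals in [measure_exch_step] equal [c], so the parts of [E] on either side of [m] get
   the same weight and recombine. *)
have ME (E : set mR) : measurable E -> M (reg `&` step @^-1` E) = mu E * c.
  move=> mE; rewrite measure_exch_step// c'c -/c muleC.
  rewrite -ge0_muleDr// -measureU//.
  - rewrite muleC -setIUr; congr (mu _ * _).
    by rewrite -setCitvr setUC setUv setIT.
  - by apply: (@measurableI _ mR) => //; exact: measurable_itv.
  - by apply: (@measurableI _ mR) => //; exact: measurable_itv.
  - by apply/seteqP; split => x //=; rewrite !in_itv/=; lra.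
have M1 : mrestr M mreg setT = c.
  rewrite /mrestr setTI -(setIT reg) -(preimage_setT step) ME//.
  by rewrite probability_setT mul1e.
have M1' : mrestr M mreg setT = (fine c)%:E by rewrite M1.
(* The Dirac mass is the default of [mnormalize] for total mass zero or infinite; here the mass is
   [c], finite and nonzero. *)
pose Q : probability _ R := mnormalize (mrestr M mreg)
    (@dirac _ (mR * mR * mR)%type (0%R : R, 0%R : R, 0%R : R) R).
have QE A : Q A = M (A `&` reg) * (fine c)^-1%:E.
  by apply: mnormalizeE; [exact: M1'|rewrite fine_eq0].
exists Q; split.
- by rewrite QE setICl measure0 mul0e.
- move=> n E mE; rewrite QE setIC.
  rewrite (measure_iter_exch_map n (mincr _ mE)) ME// [X in _ * X * _]cK -muleA.
  by rewrite -EFinM divff ?mule1// fine_eq0.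
- move=> N mN N0; have mN1 : measurable (N `*` [set: mR]) by exact: measurableX.
  have mN2 : measurable ([set: mR] `*` N) by exact: measurableX.
  have M0 (B : set (mR * mR)) : measurable B -> (mu \x mu) B = 0 ->
      M ((B `*` [set: mR]) `&` reg) = 0.
    move=> mB B0; apply/eqP.
    rewrite -measure_le0 -[leRHS](_ : M (B `*` setT) = 0).
      apply: le_measure; rewrite ?inE//.
      + by apply: measurableI => //; exact: measurableX.
      + exact: measurableX.
    (* The factor [leb setT] is infinite; the convention that zero times infinity is zero
       applies. *)
    transitivity ((mu \x mu) B * leb setT); first exact: product_measure1E.
    by rewrite B0 mul0e.
  have MN1 : (mu \x mu) (N `*` [set: mR]) = 0.
    transitivity (mu N * mu setT); first exact: product_measure1E.
    by rewrite N0 mul0e.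
  have MN2 : (mu \x mu) ([set: mR] `*` N) = 0.
    transitivity (mu setT * mu N); first exact: product_measure1E.
    by rewrite N0 mule0.
  split; rewrite QE.
  + rewrite (_ : [set p | N p.1.1] = (N `*` [set: mR]) `*` [set: mR]).
      by rewrite M0 ?mul0e.
    by apply/seteqP; split => -[[x y] v] //= [[]].
  + rewrite (_ : [set p | N p.1.2] = ([set: mR] `*` N) `*` [set: mR]).
      by rewrite M0 ?mul0e.
    by apply/seteqP; split => -[[x y] v] //= [[]].
Qed.

End exchange_law.

(** * Transfer of the law to the given probability space *)

Section transfer.
Context d (T : measurableType d) (R : realType) (P : probability T R).
Local Notation mR := (measurableTypeR R).

(** The coordinates need not be independent under [Q], so the triple is drawn as a family of one
    vector of dimension 3, with the law of [Q] carried over by [tup], and read back through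
    [untup]. *)
Lemma generates_triple (P_generates : generates_independent_vectors P)
    (Q : probability (mR * mR * mR)%type R) :
  exists Z : {RV P >-> (mR * mR * mR)%type},
    forall A, measurable A -> P (Z @^-1` A) = Q A.
Proof.
pose tup (p : mR * mR * mR) : 3.-tuple R :=
  [tuple of [:: p.1.1 : R; p.1.2 : R; p.2 : R]].
pose untup (t : 3.-tuple R) : mR * mR * mR :=
  (tnth t (inord 0), tnth t (inord 1), tnth t (inord 2)).
have tupK : cancel tup untup.
  by move=> [[x y] v]; rewrite /untup !(tnth_nth (0 : R)) !inordK.
have mtup : measurable_fun setT tup.
  apply/measurable_fun_tnthP => i.
  rewrite (_ : _ \o _ = fun p : mR * mR * mR =>
      nth (0 : R) [:: p.1.1 : R; p.1.2 : R; p.2 : R] i); last first.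
    by apply/funext => p /=; rewrite (tnth_nth (0 : R)).
  have [m1 m2 m3] := measurable_coords R.
  by case: i => -[|[|[|//]]] _ /=.
have muntup : measurable_fun setT untup.
  by apply: measurable_fun_pair; [apply: measurable_fun_pair|];
    exact: measurable_tnth.
pose ftup : {mfun (mR * mR * mR)%type >-> 3.-tuple R} :=
  mfun_Sub (mem_set mtup).
have [X [_ XE]] := P_generates 1 (fun=> 3) (fun=> distribution Q ftup).
have mZ : measurable_fun setT (untup \o X ord0).
  exact: (measurableT_comp muntup).
exists (mfun_Sub (mem_set mZ)) => A mA.
have muA : measurable (untup @^-1` A).
  by rewrite -[X in measurable X]setTI; exact: muntup.
have XA : P (X ord0 @^-1` (untup @^-1` A)) = Q (ftup @^-1` (untup @^-1` A)).
  exact: (XE ord0 _ muA).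
apply: etrans XA _; congr (Q _).
by apply/seteqP; split => p; rewrite /preimage/= tupK.
Qed.

(** This is the degenerate case excluded from [exchange_law]: positive and negative parts of [x - m]
    both have integral zero, so [x = m] almost everywhere. *)
Lemma dirac_law (mu : probability mR R) (m : R) :
  mu.-integrable setT (fun x : mR => (x : R)%:E) ->
  (\int[mu]_x (x : R)%:E = m%:E)%E ->
  (\int[mu]_x (Num.max (x - m)%R 0%R)%:E = 0)%E ->
  forall E : set mR, measurable E -> mu E = (\1_E m)%:E.
Proof.
move=> intmu meanmu c0 E mE.
have [_] := integral_max_mean intmu meanmu; rewrite c0 => c'0.
have [mm mm'] := measurable_max_sub m.
have aem : {ae mu, forall x : mR, (x : R) = m}.
  have pos (x y : R) : (0 <= (Num.max (x - y)%R 0%R)%:E)%E.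
    by rewrite lee_fin le_max lexx orbT.
  have /(ae_eq_integral_abs mu measurableT mm) ae1 :
      (\int[mu]_x `|(Num.max (x - m)%R 0%R)%:E| = 0)%E.
    by rewrite -[RHS]c0; apply: eq_integral => x _; rewrite gee0_abs.
  have /(ae_eq_integral_abs mu measurableT mm') ae2 :
      (\int[mu]_x `|(Num.max (m - x)%R 0%R)%:E| = 0)%E.
    by rewrite -[RHS]c'0; apply: eq_integral => x _; rewrite gee0_abs.
  apply: filterS2 ae1 ae2 => x /(_ I) [x1] /(_ I) [x2].
  have : x - m <= 0 by rewrite -[leRHS]x1 le_max lexx.
  have : m - x <= 0 by rewrite -[leRHS]x2 le_max lexx.
  rewrite !subr_le0 => mx xm; apply/le_anti/andP; split; [exact: xm|exact: mx].
rewrite -(setIT E) -integral_indic// (ae_eq_integral (cst (\1_E m)%:E))//.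
- by rewrite integral_cst//= probability_setT mule1 setIT.
- by apply/measurable_EFinP; exact: measurable_indic.
- by apply: filterS aem => x ->.
Qed.

(** The bound [y - x] is random but does not depend on [n]. Since [X] is chosen before [N], one
    sequence serves both claims: the complement of [[a, b]] for (a), the empty set for (b). *)
Lemma bounded_sums_of_law (P_generates : generates_independent_vectors P)
    (mu : probability mR R) (m : R) :
  mu.-integrable setT (fun x : mR => (x : R)%:E) ->
  (\int[mu]_x (x : R)%:E = m%:E)%E ->
  exists X : nat -> {RV P >-> R},
    (forall i (E : set mR), measurable E -> P (X i @^-1` E) = mu E) /\
    forall N : set mR, measurable N -> mu N = 0%E ->
      {ae P, forall w, exists x y : R, [/\ ~ N x, ~ N y &
        forall n, `|partial_sum X n w - n%:R * m| <= y - x]}.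
Proof.
move=> intmu meanmu.
have [c0|c0] := eqVneq (\int[mu]_x (Num.max (x - m)%R 0%R)%:E)%E 0%E.
  have muE := dirac_law intmu meanmu c0.
  exists (fun=> cst m); split => [i E mE|N mN N0].
    rewrite preimage_cst muE// indicE.
    by case: ifP => _; rewrite ?probability_setT ?measure0.
  (* For a point mass both endpoints are [m], which lies outside [N] because [N] is null. *)
  apply/aeW => w; exists m, m.
  have Nm : ~ N m.
    move=> Nm; move: N0; rewrite muE// indicE mem_set//= => /eqP.
    by rewrite onee_eq0.
  split => // n; rewrite /partial_sum/= sumr_const card_ord -[m *+ n]mulr_natl.
  by rewrite !subrr normr0.
have [Q [Qreg Qincr QN]] := exchange_law intmu meanmu c0.
have [Z ZQ] := generates_triple P_generates Q.
have mincr n :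
    measurable_fun setT
      ((exch_step m : mR * mR * mR -> R) \o iter n (exch_map m)).
  exact: (measurableT_comp (measurable_exch_step m)
    (measurable_iter_exch_map m n)).
have mX n : measurable_fun setT
    (((exch_step m : mR * mR * mR -> R) \o iter n (exch_map m)) \o Z).
  exact: (measurableT_comp (mincr n) (measurable_funPT Z)).
pose X n : {RV P >-> R} := @mfun_Sub _ _ T R _ (mem_set (mX n)).
exists X; split => [i E mE|N mN N0].
  rewrite -(Qincr i)// -ZQ//.
  by rewrite -[X in measurable X]setTI; exact: mincr.
have [QN1 QN2] := QN N mN N0.
have aeZ (A : set (mR * mR * mR)) : measurable A -> Q A = 0%E ->
    {ae P, forall w, ~ A (Z w)}.
  move=> mA A0; exists (Z @^-1` A); split => //.
  - by rewrite -[X in measurable X]setTI; exact: (measurable_funPT Z).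
  - by rewrite ZQ.
  - by move=> w /= /contrapT.
have a1 := aeZ _ (measurableC (measurable_exch_region m)) Qreg.
have [m1 m2 _] := measurable_coords R.
have a2 : {ae P, forall w, ~ N (Z w).1.1}.
  by apply: (aeZ [set p | N p.1.1]) => //; rewrite -[X in measurable X]setTI;
    exact: m1.
have a3 : {ae P, forall w, ~ N (Z w).1.2}.
  by apply: (aeZ [set p | N p.1.2]) => //; rewrite -[X in measurable X]setTI;
    exact: m2.
apply: filterS3 a1 a2 a3 => w /contrapT w1 w2 w3.
exists (Z w).1.1, (Z w).1.2; split => // n.
exact: (sum_exch_step_le n w1).
Qed.

End transfer.

(** * The complement of the support is null; conclusion *)

Lemma lebesgue_stieltjes_support_null (R : realType)
    (F : cumulativeBounded (0 : R) (1 : R)) (a b : R) :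
  distribution_support F `<=` `[a, b]%classic ->
  lebesgue_stieltjes_measure F (~` `[a, b]%classic) = 0%E.
Proof.
move=> suppF.
pose mu : probability (measurableTypeR R) R := lebesgue_stieltjes_measure F.
rewrite -[LHS]/(mu _).
(* Countably many null rational intervals cover the complement of [a, b]. *)
pose G (n : nat) : set (measurableTypeR R) :=
  if (unpickle n : option (rat * rat)) is Some q then
    if mu `]ratr q.1, ratr q.2[%classic == 0%E
    then `]ratr q.1, ratr q.2[%classic else set0
  else set0.
have mab : measurable (~` `[a, b]%classic : set (measurableTypeR R)).
  by apply: measurableC; exact: measurable_itv.
apply/(negligibleP mu mab).
apply: (@negligibleS _ _ _ mu (\bigcup_n G n)); last first.
  apply: negligible_bigcup => n; rewrite /G.
  case: unpickle => [q|]; last exact: negligible_set0.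
  case: ifPn => [/eqP q0|_]; last exact: negligible_set0.
  by apply/negligibleP => //; exact: measurable_itv.
move=> x /= xab.
have /existsNP[U /not_implyP[[oU Ux] U0]] : ~ distribution_support F x.
  by move=> /suppF.
have /nbhs_ballP[e /= e0 xeU] : nbhs x U by exact: open_nbhs_nbhs.
have xe : x - e < x by rewrite ltrBlDr ltrDl.
have xe' : x < x + e by rewrite ltrDl.
(* Rational endpoints on either side of [x], within [e] of it, give an interval inside the null
   neighbourhood [U], hence one of the sets [G n]. *)
have [p] := rat_in_itvoo xe; rewrite in_itv/= => /andP[px1 px2].
have [q] := rat_in_itvoo xe'; rewrite in_itv/= => /andP[qx1 qx2].
have pqU : `]ratr p, ratr q[%classic `<=` U.
  move=> y /=; rewrite in_itv/= => ypq; apply: xeU.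
  rewrite /ball/= ltr_distlC; lra.
have pq0 : mu `]ratr p, ratr q[%classic = 0%E.
  have mpq : measurable (`]ratr p, ratr q[%classic : set (measurableTypeR R)).
    exact: measurable_itv.
  have mU : measurable (U : set (measurableTypeR R)).
    exact: (open_measurable oU).
  have mupqU : (mu `]ratr p, ratr q[%classic <= mu U)%E.
    by apply: le_measure => //; rewrite inE.
  apply/eqP; rewrite -measure_le0; apply: le_trans mupqU _.
  by rewrite leNgt; apply/negP.
have [n Gn] : exists n, G n = `]ratr p, ratr q[%classic.
  by exists (pickle (p, q)); rewrite /G pickleK pq0 eqxx.
by exists n; rewrite // Gn /= in_itv/= px2 qx1.
Qed.

Lemma cvg_bounded_div (R : realType) (L : R) (s k : nat -> R) :
  (forall n, `|s n| <= L) -> k n @[n --> \oo] --> +oo ->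
  s n / k n @[n --> \oo] --> (0 : R).
Proof.
move=> sL /cvgryPgt koo; apply/cvgr0Pnorm_lt => e e0.
have L0 : 0 <= L := le_trans (normr_ge0 (s 0%N)) (sL 0%N).
(* Beyond the threshold [L / e], [k n] is positive since [L >= 0], and [L < e * k n]. *)
apply: filterS (koo (L / e)) => n kn.
have kn0 : 0 < k n by apply: le_lt_trans kn; rewrite divr_ge0// ltW.
rewrite normrM normfV (gtr0_norm kn0) ltr_pdivrMr//.
by apply: le_lt_trans (sL n) _; rewrite mulrC -ltr_pdivrMr.
Qed.

Theorem corollary2p3 (R : realType) (d : measure_display)
    (T : measurableType d) (P : probability T R)
    (P_atomless : atomless P)
    (P_generates : generates_independent_vectors P)
    (F : cumulativeBounded (0 : R) (1 : R))
    (F_mean : finite_mean F) :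
  (forall a b : R, distribution_support F `<=` `[a, b]%classic ->
    exists X : nat -> {RV P >-> R},
      (forall i : nat, has_distribution_function (X i) F) /\
      (forall n : nat, (0 < n)%N ->
        {ae P, forall w : T,
          `|partial_sum X n w - n%:R * distribution_mean F| <= b - a})) /\
  (exists X : nat -> {RV P >-> R}, extremely_negatively_dependent F X).
Proof.
(* [distribution_mean] is the [fine] part of this integral; integrability makes the two agree. *)
have meanE : (\int[lebesgue_stieltjes_measure F]_x x%:E =
    (distribution_mean F)%:E)%E.
  by rewrite fineK//; exact: integrable_fin_num F_mean.
have [X [XF Xbnd]] := bounded_sums_of_law P_generates
  (mu := lebesgue_stieltjes_measure F) F_mean meanE.
have XdfF i : has_distribution_function (X i) F.
  move=> r; rewrite -cdf_lebesgue_stieltjes_id.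
  by apply: (XF i `]-oo, r]%classic); exact: measurable_itv.
split=> [a b suppF|].
  exists X; split => // n _.
  have mab : measurable (~` `[a, b]%classic : set (measurableTypeR R)).
    by apply: measurableC; exact: measurable_itv.
  have aeX := Xbnd _ mab (lebesgue_stieltjes_support_null suppF).
  (* Both endpoints lie in [[a, b]], hence [y - x <= b - a]. *)
  apply: filterS aeX => w [x [y [/contrapT /= + /contrapT /= + /(_ n)]]].
  by rewrite !in_itv/=; lra.
exists X; split => // k koo.
(* A bound depending on [w] is enough, as the convergence is pointwise in [w]. *)
have aeX := Xbnd set0 measurable0 (measure0 _).
apply: filterS aeX => w [x [y [_ _ sum_le]]].
exact: (cvg_bounded_div sum_le).
Qed.
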